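(* For every integer $n \ge 2$, \[ \mathrm{lcs}(n) \;\ge\; n^2\left(1-\frac{2+\ln 2}{\ln n}\right) + n\left(1+\frac{\ln(8\pi)}{\ln n}\right) - \frac{\ln 2}{\ln n}, \] where $\mathrm{lcs}(n)$ denotes the size of the largest critical set in any Latin square of order $n$.
   Context: A Latin square of order $n$ is an $n\times n$ array with entries from $X=\{1,2,\ldots,n\}$ such that each element of $X$ occurs exactly once in each row and exactly once in each column. It is identified with the set of ordered triples $\{(i,j;k) \mid \text{symbol } k \text{ occurs in cell } (i,j)\}$. A partial Latin square of order $n$ is an $n\times n$ array, with some cells possibly empty, whose filled cells contain elements of $X$ such that each element of $X$ occurs at most once in each row and at most once in each column. It is likewise identified with its set of triples $P$, and its size is $|P|$, the number of filled cells. A partial Latin square $C$ contained in a Latin square $L$ of order $n$ (that is, $C\subseteq L$ as sets of triples) is uniquely completable if $L$ is the only Latin square of order $n$ having symbol $k$ in cell $(i,j)$ for every $(i,j;k)\in C$. A critical set $C$ contained in a Latin square $L$ is a partial Latin square $C\subseteq L$ that is uniquely completable and such that no proper subset of $C$ is uniquely completable (to $L$). $\mathrm{lcs}(n)$ denotes the maximum of $|C|$ over all critical sets $C$ contained in any Latin square of order $n$. $\ln$ is the natural logarithm. *)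

(* Defs.v *)
From mathcomp Require Import all_boot.

Set Implicit Arguments.
Unset Strict Implicit.
Unset Printing Implicit Defensive.

(* An n x n array (some cells possibly empty) is given by its set of triples
   (i, j, k), meaning that symbol k occurs in cell (i, j). Rows, columns and
   symbols are indexed by {0, ..., n-1} instead of {1, ..., n}. *)
Definition triples (n : nat) : finType := ('I_n * 'I_n * 'I_n)%type.

Definition symbols_at n (P : {set triples n}) (i j : 'I_n) : {set 'I_n} :=
  [set k | (i, j, k) \in P].

Definition columns_of n (P : {set triples n}) (i k : 'I_n) : {set 'I_n} :=
  [set j | (i, j, k) \in P].

Definition rows_of n (P : {set triples n}) (j k : 'I_n) : {set 'I_n} :=
  [set i | (i, j, k) \in P].

(* The first conjunct says that P comes from an array: a cell holds at most one
   symbol. *)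
Definition partial_latin n (P : {set triples n}) : bool :=
  [&& [forall i, forall j, #|symbols_at P i j| <= 1],
      [forall i, forall k, #|columns_of P i k| <= 1]
    & [forall j, forall k, #|rows_of P j k| <= 1]].

Definition latin n (L : {set triples n}) : bool :=
  [&& [forall i, forall j, #|symbols_at L i j| == 1],
      [forall i, forall k, #|columns_of L i k| == 1]
    & [forall j, forall k, #|rows_of L j k| == 1]].

Definition uniquely_completable n (L C : {set triples n}) : bool :=
  [&& latin L, partial_latin C, C \subset L
    & [forall L' : {set triples n}, latin L' && (C \subset L') ==> (L' == L)]].

Definition critical_set n (L C : {set triples n}) : bool :=
  uniquely_completable L C &&
  [forall D : {set triples n}, (D \proper C) ==> ~~ uniquely_completable L D].

Definition lcs (n : nat) : nat :=
  \max_(C : {set triples n} | [exists L, critical_set L C]) #|C|.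

(* Main.v *)
Require Import Defs.
From mathcomp Require Import boolp classical_sets functions.
From mathcomp Require Import topology normedtype derive realfun sequences.
From mathcomp Require Import all_boot all_order all_algebra all_fingroup.
From mathcomp Require Import all_field.
From mathcomp Require Import ring lra.
From mathcomp Require Import reals exp trigo.

(** The bound comes from counting Latin squares of order n in two ways.

    Upper bound. The cells outside one row and one column determine a Latin
    square: a partly known line has a single symbol left for its missing cell.
    Hence every Latin square contains a critical set living on these (n-1)^2
    cells, and a critical set determines its square. There are at most
    2^((n-1)^2) shapes for such a set, and at most n^lcs(n) fillings of each
    shape ([card_latin_le]).

    Lower bound. A Latin square is built row by row. When r rows are filled,
    the relation <<symbol k is still free in column j>> is (n-r)-regular, and
    the possible next rows are the permutations compatible with it. By the
    van der Waerden bound ([regular_permanent_ge]) there are at least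
    (n-r)^n n!/n^n of them, so at least n!^(2n) / n^(n^2) squares in all
    ([card_latin_ge]).

    The van der Waerden bound is proved by the method of Gurvits. The permanent
    of A is the coefficient of x_1 ... x_n in the polynomial
    P(x) = prod_i sum_j a_ij x_j. The variables are eliminated one at a time:
    a polynomial in x_j is replaced with its coefficient of x_j^1. If a_ij > 0,
    the polynomials obtained do not vanish when all variables have a positive
    real part ([stable_all]). So for positive values of the other variables,
    each of them is a polynomial in x_j with negative roots only
    ([mixed_poly_root_lt0]), and the AM-GM inequality compares its linear
    coefficient with its values ([real_rooted_coef1]): a lower bound
    c prod x_i is inherited with c multiplied by ((k-1)/k)^(k-1), k being the
    number of variables left ([cap_geU1]). The product of these factors
    is n!/n^n. For a k-regular 0-1 matrix the bound that starts this chain,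
    P(x) >= k^n prod x_i, is AM-GM again ([regular_cap]); positivity of the
    entries is obtained by adding eps to all of them and letting eps tend to 0.

    The two counts are compared through Stirling's lower bound
    n! >= sqrt(2 pi n) (n/e)^n ([ln_fact_ge]). It follows from the Wallis
    estimate (2n choose n) <= 4^n / sqrt(pi n), which says that
    e_n = ln (n! / (sqrt(2 pi n) (n/e)^n)) satisfies e_(2n) <= 2 e_n: a negative
    e_n would make e_(2^k n) decrease like - 2^k, whereas n! >= (n/e)^n shows
    that it decreases at most linearly in k. *)
Set Implicit Arguments.
Unset Strict Implicit.
Unset Printing Implicit Defensive.
Import Order.TTheory GRing.Theory Num.Theory.
Import numFieldNormedType.Exports.
Local Open Scope ring_scope.

(** * Extracting coefficients of a product of linear forms *)
Section HitOnce.
Variable I : finType.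
Implicit Types (T : {set I}) (s : {ffun I -> I}).

(** The monomial of P = prod_i sum_j a_ij x_j chosen by [s : I -> I] has degree
    #|s^-1 j| in x_j; so these are the terms kept once the coefficient of
    x_j^1 has been taken for every j in [T]. *)
Definition hits_once T s := [forall j in T, #|[set i | s i == j]| == 1%N].

Lemma hits_onceU1 T j s : j \notin T ->
  hits_once (j |: T) s = hits_once T s && (#|[set i | s i == j]| == 1%N).
Proof.
move=> jT; apply/forall_inP/andP => [h|[/forall_inP h hj] l].
  split; last by apply: h; rewrite setU11.
  by apply/forall_inP => l lT; apply: h; rewrite in_setU1 lT orbT.
by rewrite in_setU1 => /predU1P[->|/h].
Qed.

Lemma card_hits_once T s : hits_once T s -> #|[set i | s i \in T]| = #|T|.
Proof.
move=> /forall_inP h; rewrite -!sum1_card.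
rewrite (partition_big s (mem T)) => [|i]; last by rewrite inE.
apply: eq_bigr => j jT; rewrite -[RHS](eqP (h j jT)) -[RHS]sum1_card.
apply: eq_bigl => i; rewrite !inE.
by case: eqP => [->|_]; rewrite ?(jT : j \in T) ?andbF.
Qed.

Lemma card_hits_onceC T s :
  hits_once T s -> #|[set i | s i \notin T]| = #|~: T|.
Proof.
move=> h; apply/eqP; rewrite -(eqn_add2l #|T|) cardsC -{1}(card_hits_once h).
rewrite -(cardsC [set i | s i \in T]) eqn_add2l; apply/eqP; apply: eq_card => i.
by rewrite !inE.
Qed.

Lemma hits_once0 s : hits_once set0 s.
Proof. by apply/forall_inP => j; rewrite inE. Qed.

End HitOnce.

Section Partial.
Variables (K : comNzRingType) (I : finType) (a : I -> I -> K).
Implicit Types (T : {set I}) (s : {ffun I -> I}) (y : I -> K) (t : K).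

(** Coefficient of prod_(j in T) x_j in prod_i sum_j a_ij x_j, as a polynomial
    in the variables outside [T], evaluated at [y]. It is the product itself
    when [T] is empty and the permanent when [T] is full. *)
Definition mixed_coef T y : K :=
  \sum_(s | hits_once T s) \prod_i (a i (s i) * (if s i \in T then 1 else y (s i))).

Definition update y j t l := if l == j then t else y l.

(** The same value as a polynomial in the single variable x_j, the others being
    fixed: see [horner_mixed_poly]. *)
Definition mixed_poly T j y : {poly K} :=
  \sum_(s | hits_once T s)
    (\prod_i (a i (s i) * (if s i \in j |: T then 1 else y (s i))))
      *: 'X^#|[set i | s i == j]|.

Lemma horner_mixed_poly T j y t : j \notin T ->
  (mixed_poly T j y).[t] = mixed_coef T (update y j t).
Proof.
move=> jT; rewrite horner_sum; apply: eq_bigr => s _.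
rewrite hornerZ hornerXn -prodr_const [X in _ * X]big_mkcond -big_split /=.
apply: eq_bigr => i _; rewrite !inE /update; case: eqP => [->|_] /=.
  by rewrite (negPf jT) mulr1.
by rewrite mulr1.
Qed.

Lemma coef1_mixed_poly T j y : j \notin T ->
  (mixed_poly T j y)`_1 = mixed_coef (j |: T) y.
Proof.
move=> jT; rewrite coef_sum /mixed_coef.
under [RHS]eq_bigl do rewrite hits_onceU1 //.
rewrite big_mkcondr /=; apply: eq_bigr => s _; rewrite coefZ coefXn eq_sym.
by case: eqP; rewrite ?mulr1 ?mulr0.
Qed.

Lemma mixed_coefZ T y t :
  mixed_coef T (fun l => t * y l) = t ^+ #|~: T| * mixed_coef T y.
Proof.
rewrite mulr_sumr; apply: eq_bigr => s /card_hits_onceC <-.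
rewrite -prodr_const [X in X * _]big_mkcond -big_split /=; apply: eq_bigr => i _.
rewrite inE; case: ifP => _ /=; first by rewrite mul1r.
by rewrite mulrCA.
Qed.

Lemma eq_mixed_coef T y y' : {in ~: T, y =1 y'} -> mixed_coef T y = mixed_coef T y'.
Proof.
move=> h; apply: eq_bigr => s _; apply: eq_bigr => i _.
by case: ifPn => // sT; rewrite h // inE.
Qed.

Lemma card_fiber_le T j s : j \notin T -> hits_once T s ->
  (#|[set i | s i == j]| <= #|~: T|)%N.
Proof.
move=> jT /card_hits_onceC <-; apply/subset_leq_card/subsetP => i.
by rewrite !inE => /eqP->.
Qed.

(** In the monomials of top degree every row outside the fibers of [T] chooses
    [j], so that the other variables do not occur. *)
Lemma top_coef_mixed_poly T j y : j \notin T ->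
  (mixed_poly T j y)`_(#|~: T|) =
  \sum_(s | hits_once T s && (#|[set i | s i == j]| == #|~: T|))
    \prod_i a i (s i).
Proof.
move=> jT; rewrite coef_sum big_mkcondr /=; apply: eq_bigr => s hs.
rewrite coefZ coefXn eq_sym; case: eqP => [e|]; rewrite ?mulr1 ?mulr0 //.
apply: eq_bigr => i _; rewrite in_setU1.
have: [set i | s i == j] == [set i | s i \notin T].
  rewrite eqEcard e card_hits_onceC // leqnn andbT.
  by apply/subsetP => l; rewrite !inE => /eqP->.
move/eqP/setP/(_ i); rewrite !inE => ->.
by case: (s i \in T); rewrite mulr1.
Qed.

Lemma size_mixed_poly T j y : j \notin T ->
  (size (mixed_poly T j y) <= #|~: T|.+1)%N.
Proof.
move=> jT; apply: leq_trans (size_sum _ _ _) _; apply/bigmax_leqP => s hs.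
apply: leq_trans (size_scale_leq _ _) _; rewrite size_polyXn ltnS.
exact: card_fiber_le.
Qed.

End Partial.

(** * Stability and real-rootedness *)
Section Stability.
Variables (C : numClosedFieldType) (I : finType) (a : I -> I -> C).
Hypothesis a_gt0 : forall i j, 0 < a i j.
Implicit Types (T : {set I}) (z : I -> C).

(** Positivity makes the degree in x_j the same for all values of the other
    variables, which avoids any limit argument below. *)
Lemma top_coef_mixed_poly_gt0 T j z : j \notin T ->
  0 < (mixed_poly a T j z)`_(#|~: T|).
Proof.
move=> jT; rewrite top_coef_mixed_poly //.
pose s := [ffun i => if i \in T then i else j].
have es l : l \in T -> [set i | s i == l] = [set l].
  move=> lT; apply/setP => i; rewrite !inE ffunE; case: ifPn => // iT.
  by rewrite eq_sym (negPf (memPn jT _ lT)) eq_sym (negPf (memPn iT _ lT)).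
rewrite (bigD1 s) /=.
  apply: ltr_wpDr; first by apply: sumr_ge0 => ? _; apply: prodr_ge0 => i _; apply: ltW.
  by apply: prodr_gt0.
apply/andP; split.
  by apply/forall_inP => l lT; rewrite es // cards1.
apply/eqP/eq_card => i; rewrite !inE ffunE; case: ifPn => [iT|]; last by rewrite eqxx.
by apply: contraNF jT => /eqP <-.
Qed.

Lemma size_mixed_polyE T j z : j \notin T ->
  size (mixed_poly a T j z) = #|~: T|.+1.
Proof.
move=> jT; apply/eqP; rewrite eqn_leq size_mixed_poly //= ltnNge.
apply/negP => /leq_sizeP/(_ _ (leqnn _))/eqP; apply/negP.
by rewrite gt_eqF // top_coef_mixed_poly_gt0.
Qed.

(** Half-plane stability, reaching a part of the boundary: it is enough that
    one variable lies in the open right half-plane. This form can be used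
    with a variable set to 0. The points with purely imaginary coordinates must
    be left out, as even a positive linear form may vanish there. *)
Definition stable T := forall z,
  (forall j, j \notin T -> 0 <= 'Re (z j)) ->
  (exists2 j, j \notin T & 0 < 'Re (z j)) -> mixed_coef a T z != 0.

(** The ratio is the logarithmic derivative at 0, that is the sum of the
    - 1/w over the roots w, and - 1/w has a positive real part with - w. *)
Lemma Re_coef1_ratio (r : seq C) (q := \prod_(w <- r) ('X - w%:P)) :
  {in r, forall w, 'Re w < 0} ->
  q`_0 != 0 /\ (if r is [::] then 'Re (q`_1 / q`_0) = 0 else 0 < 'Re (q`_1 / q`_0)).
Proof.
rewrite {}/q; elim: r => [_|w r IH h].
  by rewrite big_nil !coef1 eqxx oner_eq0 mul0r raddf0.
have hw : 'Re w < 0 by apply: h; rewrite mem_head.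
have w0 : w != 0 by apply: contraTneq hw => ->; rewrite raddf0 ltxx.
case: IH => [v vr|q0 hq]; first by apply: h; rewrite in_cons vr orbT.
have {hq} : 0 <= 'Re ((\prod_(w <- r) ('X - w%:P))`_1 /
                       (\prod_(w <- r) ('X - w%:P))`_0).
  by case: {+}r hq => [->|? ? /ltW].
rewrite big_cons; set q := \prod_(_ <- _) _ in q0 * => hq.
rewrite mulrBl !coefB !coefXM !coefCM /= sub0r oppr_eq0 mulf_neq0 //; split => //.
have -> : (q`_0 - w * q`_1) / (- (w * q`_0)) = q`_1 / q`_0 - w^-1.
  by field; rewrite q0 w0.
rewrite raddfB /= ReV -mulNr ltr_wpDl // divr_gt0 ?oppr_gt0 //.
by rewrite exprn_gt0 // normr_gt0.
Qed.

(** For admissible z, all roots of the polynomial in x_j have a negative real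
    part because [T] is stable; hence its linear coefficient is nonzero by
    [Re_coef1_ratio]. *)
Lemma stableU1 T j : j \notin T -> stable T -> stable (j |: T).
Proof.
move=> jT st z z_ge0 [l]; rewrite in_setU1 negb_or => /andP[lj lT] zl.
rewrite -coef1_mixed_poly //.
set p := mixed_poly _ _ _ _.
have p_nz w : 0 <= 'Re w -> p.[w] != 0.
  move=> hw; rewrite horner_mixed_poly // st //.
    move=> i iT; rewrite /update; case: eqP => // /eqP ij.
    by apply: z_ge0; rewrite in_setU1 negb_or ij.
  by exists l => //; rewrite /update (negPf lj).
have [r dp] := closed_field_poly_normal p.
have lc_nz : lead_coef p != 0.
  rewrite lead_coef_eq0; apply: contraNneq (p_nz 0 _) => [->|]; first by rewrite horner0.
  by rewrite raddf0.
have r_neg : {in r, forall w, 'Re w < 0}.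
  move=> w wr; rewrite real_ltNge ?Creal_Re ?real0 //.
  apply/negP => /p_nz; rewrite dp hornerZ mulf_eq0 (negPf lc_nz) /= => /negP[].
  by rewrite -rootE root_prod_XsubC.
have [q0] := Re_coef1_ratio r_neg; case: r {r_neg} dp q0 => [|v r] dp q0.
  have := size_mixed_polyE z jT; rewrite -/p dp big_nil alg_polyC size_polyC lc_nz.
  move=> [] /esym/eqP; rewrite cards_eq0 => /eqP/setP/(_ j); by rewrite !inE jT.
move=> h; rewrite dp coefZ mulf_neq0 //.
by apply: contraTneq h => ->; rewrite mul0r raddf0 ltxx.
Qed.

Lemma mixed_coef0 z : mixed_coef a set0 z = \prod_i \sum_l a i l * z l.
Proof.
rewrite bigA_distr_bigA; apply: eq_big => s; first by rewrite hits_once0.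
by move=> _; apply: eq_bigr => i _; rewrite inE.
Qed.

Lemma stable0 : stable set0.
Proof.
move=> z z_ge0 [j _ zj]; rewrite mixed_coef0; apply/prodf_neq0 => i _.
suff: 0 < 'Re (\sum_l a i l * z l).
  by apply: contraTneq => ->; rewrite raddf0 ltxx.
have aR l : a i l \is Num.real by rewrite gtr0_real.
rewrite raddf_sum (bigD1 j) //= ReMl // ltr_wpDr ?mulr_gt0 //.
apply: sumr_ge0 => l _; rewrite ReMl // mulr_ge0 ?(ltW (a_gt0 _ _)) //.
by apply: z_ge0; rewrite inE.
Qed.

Lemma stable_all T : stable T.
Proof.
have [m] := ubnP #|T|; elim: m T => // m IH T.
have [->|[j jT]] := set_0Vmem T; first by move=> _; exact: stable0.
rewrite (cardsD1 j) jT => hT; rewrite -(setD1K jT).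
by apply: stableU1; [rewrite setD11|exact: IH].
Qed.

(** By homogeneity a zero (x, w) yields the zeros (t x, t w). Unless w <= 0, the
    factor t = 1 + conj (w / |w|) turns the positive reals and w to directions
    symmetric about the real axis, both in the open right half-plane, which
    contradicts stability. *)
Lemma mixed_poly_root_lt0 T j (x : I -> C) w :
  j \notin T -> (exists2 l, l \notin T & l != j) ->
  (forall l, 0 < x l) -> root (mixed_poly a T j x) w -> w < 0.
Proof.
move=> jT [l lT lj] x0; rewrite rootE horner_mixed_poly // => pw0.
have xR i : x i \is Num.real by rewrite gtr0_real.
have Rex i : 'Re (x i) = x i by apply/Creal_ReP.
have [w0|w_nz] := eqVneq w 0.
  suff: mixed_coef a T (update x j w) != 0 by rewrite (eqP pw0) eqxx.
  apply: stable_all.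
    move=> i _; rewrite /update; case: ifP => _; first by rewrite w0 raddf0.
    by rewrite Rex ltW.
  by exists l => //; rewrite /update (negPf lj) Rex.
have nw : `|w| != 0 by rewrite normr_eq0.
pose u := w / `|w|.
have nu : `|u| = 1 by rewrite normrM normfV normr_id mulfV.
have wE : w = `|w| * u by rewrite /u mulrC divfK.
have [] := leif_Re_Creal (- u); rewrite raddfN normrN nu => hu eu.
case: (boolP (0 <= - u)) => [u_le0|u_nle0].
  rewrite lt_def eq_sym w_nz wE /= -oppr_ge0 -mulrN mulr_ge0 //.
have {eu} hu' : 0 < 1 + 'Re u.
  by rewrite -[X in _ + X]opprK subr_gt0 lt_neqAle hu eu u_nle0.
(* Re t and Re (t w) are positive multiples of 1 + Re u, as |u| = 1. *)
pose t := 1 + u^*.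
have Ret : 'Re t = 1 + 'Re u by rewrite raddfD /= Re_conj (Creal_ReP _ _) ?real1.
have tw : t * w = `|w| * (1 + u).
  have uu : u * u^* = 1 by rewrite -normCK nu expr1n.
  by rewrite wE /t -[X in _ = _ * (X + _)]uu normrM normr_id nu mulr1; ring.
suff: mixed_coef a T (fun i => t * update x j w i) != 0.
  by rewrite mixed_coefZ (eqP pw0) mulr0 eqxx.
apply: stable_all.
  move=> i _; rewrite /update; case: ifP => _.
    rewrite tw ReMl ?normr_real // mulr_ge0 // raddfD /= (Creal_ReP _ _) ?real1 //.
    exact: ltW.
  by rewrite ReMr // Ret mulr_ge0 // ltW.
by exists l => //; rewrite /update (negPf lj) ReMr // mulr_gt0 ?Ret.
Qed.

(** * The capacity inequality *)
Lemma prod1D_le (b : seq C) : {in b, forall c, 0 <= c} ->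
  \prod_(c <- b) (1 + c) <= (1 + (\sum_(c <- b) c) / (size b)%:R) ^+ size b.
Proof.
move=> b0; have [->|bn] := eqVneq b [::]; first by rewrite big_nil expr0.
have sb : (size b)%:R != 0 :> C by rewrite pnatr_eq0 size_eq0.
rewrite (big_nth 0) big_mkord [\sum_(_ <- _) _](big_nth 0) big_mkord.
have := (@leif_AGM C _ 'I_(size b) (fun i => 1 + b`_i) _).1.
rewrite card_ord big_split /= sumr_const card_ord mulrDl divff //; apply.
by move=> i _; rewrite addr_ge0 // b0 // mem_nth.
Qed.

Lemma coef1_prod_XsubC (r : seq C) (q := \prod_(w <- r) ('X - w%:P)) :
  0 \notin r -> q`_1 = q`_0 * \sum_(w <- r) - w^-1.
Proof.
rewrite {}/q; elim: r => [_|w r IH].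
  by rewrite !big_nil !coef1 mulr0.
rewrite in_cons negb_or eq_sym => /andP[w0 /IH {}IH].
rewrite !big_cons mulrBl !coefB !coefXM !coefCM /= sub0r IH.
by field.
Qed.

Lemma horner_prod_XsubC (r : seq C) t (q := \prod_(w <- r) ('X - w%:P)) :
  0 \notin r -> q.[t] = q`_0 * \prod_(w <- r) (1 + t * - w^-1).
Proof.
rewrite {}/q; elim: r => [_|w r IH].
  by rewrite !big_nil !coef1 hornerC mulr1.
rewrite in_cons negb_or eq_sym => /andP[w0 /IH {}IH].
rewrite !big_cons mulrBl !coefB !coefXM !coefCM /= sub0r -mulrBl hornerM IH.
by rewrite hornerXsubC; field.
Qed.

(** The minimum over t > 0 of (1 + t)^k / t is k / [gurvits_factor k] for
    k > 1, reached at t = 1 / (k-1); the value is 0^0 = 1 for k = 1. *)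
Definition gurvits_factor (k : nat) : C := (k.-1%:R / k%:R) ^+ k.-1.

(** If the roots are the - r_i, then p(t) = p(0) prod_i (1 + t/r_i), which AM-GM
    bounds by p(0) (1 + t S / k)^k with S = sum_i 1/r_i and p'(0) = p(0) S. *)
Lemma real_rooted_coef1 (p : {poly C}) k :
  (1 < k)%N -> size p = k.+1 -> 0 < lead_coef p ->
  (forall w, root p w -> w < 0) ->
  exists2 t, 0 < t & p.[t] * gurvits_factor k <= t * p`_1.
Proof.
move=> k1 sp lc0 roots.
have [r dp] := closed_field_poly_normal p.
have r0 w : w \in r -> w < 0.
  move=> wr; apply: roots; rewrite dp rootE hornerZ mulf_eq0 -rootE.
  by rewrite root_prod_XsubC wr orbT.
have r0n : 0 \notin r by apply/negP => /r0; rewrite ltxx.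
have sr : size r = k.
  by move: sp; rewrite dp size_scale ?gt_eqF // size_prod_XsubC => -[].
have kk : (k%:R = k.-1%:R + 1 :> C) by rewrite natr1 prednK // ltnW.
have k0 : 0 < k.-1%:R :> C by rewrite ltr0n -ltnS prednK // ltnW.
pose S := \sum_(w <- r) - w^-1.
have S0 : 0 < S.
  rewrite /S; case: (r) sr r0 => [e|w r' _ h]; first by rewrite -e in k1.
  rewrite big_cons ltr_wpDr // ?oppr_gt0 ?invr_lt0 ?h ?mem_head //.
  rewrite big_seq; apply: sumr_ge0 => v vr; rewrite oppr_ge0 invr_le0 ltW // h //.
  by rewrite in_cons vr orbT.
have p0 : p`_0 = lead_coef p * (\prod_(w <- r) ('X - w%:P))`_0 by rewrite {1}dp coefZ.
have p0_gt0 : 0 < p`_0.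
  rewrite p0 mulr_gt0 // -horner_coef0 horner_prod big_seq prodr_gt0 // => w wr.
  by rewrite hornerXsubC sub0r oppr_gt0 r0.
have p1 : p`_1 = p`_0 * S by rewrite p0 {1}dp coefZ coef1_prod_XsubC // mulrA.
(* The minimizer of (1 + t S / k)^k / t. *)
pose t := k%:R / (k.-1%:R * S).
have t0 : 0 < t by rewrite divr_gt0 ?mulr_gt0 // kk ltr_wpDr.
exists t => //.
have -> : p.[t] = p`_0 * \prod_(w <- r) (1 + t * - w^-1).
  by rewrite p0 {1}dp hornerZ horner_prod_XsubC // mulrA.
have -> : \prod_(w <- r) (1 + t * - w^-1) =
    \prod_(c <- [seq t * - w^-1 | w <- r]) (1 + c).
  by rewrite big_map.
apply: le_trans (ler_wpM2r _ (ler_wpM2l _ (prod1D_le _))) _.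
- by rewrite exprn_ge0 // divr_ge0 ?ler0n.
- exact: ltW.
- by move=> c /mapP[w wr ->]; rewrite mulr_ge0 ?ltW // oppr_gt0 invr_lt0 r0.
rewrite size_map sr big_map -mulr_sumr -/S p1.
have -> : 1 + t * S / k%:R = k%:R / k.-1%:R.
  by rewrite /t kk; field; rewrite !gt_eqF // addr_gt0.
rewrite le_eqVlt; apply/orP; left; apply/eqP.
have -> : (k%:R / k.-1%:R) ^+ k = (k%:R / k.-1%:R) * (k%:R / k.-1%:R) ^+ k.-1 :> C.
  by rewrite -exprS prednK // ltnW.
rewrite /gurvits_factor !mulrA -mulrA -exprMn.
have -> : k%:R / k.-1%:R * (k.-1%:R / k%:R) = 1 :> C.
  by rewrite kk; field; rewrite !gt_eqF // addr_gt0.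
by rewrite expr1n /t; field; rewrite !gt_eqF.
Qed.

(** A lower bound for the capacity inf_(x > 0) f(x) / prod_i x_i of the
    polynomial f left after the elimination of [T], stated without infimum. *)
Definition cap_ge T (c : C) := forall x : I -> C, (forall i, 0 < x i) ->
  c * \prod_(i in ~: T) x i <= mixed_coef a T x.

(** With one variable left, the polynomial is homogeneous of degree 1. This case
    is apart because no finite t minimizes (1 + t) / t. *)
Lemma mixed_poly_last T j x : j \notin T -> #|~: T| = 1%N ->
  mixed_coef a T x = x j * mixed_coef a (j |: T) x.
Proof.
move=> jT T1.
have Tj : ~: T = [set j].
  by apply/esym/eqP; rewrite eqEcard sub1set inE jT cards1 T1.
have pE t : (mixed_poly a T j x).[t] = t * (mixed_poly a T j x).[1].
  rewrite !horner_mixed_poly // -{2}[t]expr1 -T1 -mixed_coefZ.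
  apply: eq_mixed_coef => i; rewrite Tj inE => /eqP->.
  by rewrite /update eqxx mulr1.
have -> : mixed_coef a T x = (mixed_poly a T j x).[x j].
  rewrite horner_mixed_poly //; apply: eq_mixed_coef => i.
  by rewrite Tj inE => /eqP->; rewrite /update eqxx.
rewrite pE -coef1_mixed_poly //; congr (_ * _).
have p0 := pE 0; rewrite mul0r horner_coef0 in p0.
rewrite horner_coef size_mixed_polyE // T1 !big_ord_recl big_ord0 /=.
by rewrite p0 mul0r expr1n mulr1 add0r addr0.
Qed.

(** The capacity bound is applied at the value t of x_j that
    [real_rooted_coef1] provides. *)
Lemma cap_geU1 T j c : j \notin T -> cap_ge T c ->
  cap_ge (j |: T) (c * gurvits_factor #|~: T|).
Proof.
move=> jT hc x x0.
have split (y : I -> C) : \prod_(i in ~: T) y i = y j * \prod_(i in ~: (j |: T)) y i.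
  rewrite (bigD1 j) /= ?inE //; congr (_ * _); apply: eq_bigl => i.
  by rewrite !inE negb_or andbC.
have : (0 < #|~: T|)%N by rewrite (cardD1 j) inE jT.
rewrite leq_eqVlt => /predU1P[T1|k1].
  have := hc x x0; rewrite (mixed_poly_last x jT) // split /gurvits_factor -T1 expr0 mulr1.
  by rewrite mulrCA ler_pM2l.
have lc0 : 0 < lead_coef (mixed_poly a T j x).
  by rewrite lead_coefE size_mixed_polyE //= top_coef_mixed_poly_gt0.
have roots w : root (mixed_poly a T j x) w -> w < 0.
  apply: mixed_poly_root_lt0 => //.
  move: k1; rewrite (cardsD1 j) inE jT => /card_gt0P[l].
  by rewrite !inE => /andP[lj lT]; exists l.
have [t t0 ht] := real_rooted_coef1 k1 (size_mixed_polyE x jT) lc0 roots.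
rewrite coef1_mixed_poly // horner_mixed_poly // in ht.
rewrite -(ler_pM2l t0); apply: le_trans ht.
have x'0 i : 0 < update x j t i by rewrite /update; case: ifP.
have := hc _ x'0; rewrite split {1}/update eqxx => h.
have gk : 0 <= gurvits_factor #|~: T| by rewrite exprn_ge0 // divr_ge0 ?ler0n.
apply: le_trans (ler_wpM2r gk h); rewrite le_eqVlt; apply/orP; left; apply/eqP.
rewrite [X in c * (t * X)](eq_bigr x); first by ring.
by move=> i; rewrite !inE negb_or /update => /andP[/negPf->].
Qed.

(** The permanent bound for positive matrices: the factors
    ((k-1)/k)^(k-1) telescope, being the quotients of consecutive values of
    k!/k^k. *)
Theorem mixed_coefT_ge c y : cap_ge set0 c ->
  c * (#|I|)`!%:R / #|I|%:R ^+ #|I| <= mixed_coef a setT y.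
Proof.
move=> c0; pose n := #|I|.
(* [f m] is the factor collected when m variables are left. *)
pose f m : C := n`!%:R / n%:R ^+ n * (m%:R ^+ m / m`!%:R).
have n0 m : (m%:R ^+ m != 0 :> C) by rewrite -natrX pnatr_eq0 -lt0n expn_gt0; case: m.
have nf m : m`!%:R != 0 :> C by rewrite pnatr_eq0 -lt0n fact_gt0.
have fS m : f m.+1 * gurvits_factor m.+1 = f m.
  rewrite /f /gurvits_factor /= factS natrM expr_div_n exprS.
  have m0 : m.+1%:R != 0 :> C by rewrite pnatr_eq0.
  by field; rewrite nf n0 expf_neq0 // addrC natr1 m0.
suff H T : cap_ge T (c * f #|~: T|).
  have := H setT (fun=> 1) (fun=> ltr01); rewrite setCT big_set0 cards0 mulr1.
  rewrite /f expr0 fact0 divr1 mulr1 mulrA (@eq_mixed_coef _ _ _ _ _ y) //.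
  by move=> i; rewrite !inE.
have [m] := ubnP #|T|; elim: m T => // m IH T.
have [->|[j jT]] := set_0Vmem T.
  have -> : f #|~: (set0 : {set I})| = 1.
    by rewrite setC0 cardsT -/n /f; field; rewrite n0 nf.
  by rewrite mulr1.
rewrite (cardsD1 j) jT => hT.
have jT' : j \notin T :\ j by rewrite setD11.
have := cap_geU1 jT' (IH _ hT); rewrite setD1K // -mulrA.
have -> : #|~: (T :\ j)| = #|~: T|.+1.
  rewrite (cardsD1 j) !inE eqxx /=; congr _.+1; apply: eq_card => i; rewrite !inE.
  by case: eqP => [->|]; rewrite ?jT // ?andbT.
by rewrite fS.
Qed.

End Stability.

(** * The van der Waerden bound for regular relations *)
Section RegularPermanent.
Variable I : finType.
Implicit Types (e : rel I) (C : numClosedFieldType).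

(** Continuity at 0 from the right, made explicit: q(eps) - q(0) is at most
    eps times the sum of the coefficients when eps <= 1. *)
Lemma nneg_poly_ge_at0 C (q : {poly C}) c : (forall i, 0 <= q`_i) ->
  (forall eps, 0 < eps -> c <= q.[eps]) -> c <= q.[0].
Proof.
move=> q0 h; apply/ler_addgt0Pr => d d0.
have [p qE] : exists p, q = p * 'X + (q`_0)%:P.
  exists (\poly_(i < size q) q`_i.+1); apply/polyP => -[|i];
    rewrite coefD coefMX coefC /= ?add0r // addr0 coef_poly.
  by case: ltnP => // hi; rewrite nth_default // (leq_trans hi).
have p0 i : 0 <= p`_i by have := q0 i.+1; rewrite qE coefD coefMX coefC addr0.
have p1 : 0 <= p.[1].
  by rewrite horner_coef sumr_ge0 // => i _; rewrite expr1n mulr1.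
pose eps := d / (1 + d + p.[1]).
have den : 0 < 1 + d + p.[1] by rewrite ltr_wpDr // addr_gt0.
have eps0 : 0 < eps by rewrite divr_gt0.
apply: le_trans (h _ eps0) _.
rewrite qE !(hornerD, hornerMX, hornerC) mulr0 add0r addrC lerD2l.
have : p.[eps] <= p.[1].
  rewrite !horner_coef; apply: ler_sum => i _; rewrite expr1n ler_wpM2l //.
  apply: exprn_ile1; first exact: ltW.
  by rewrite ler_pdivrMr // mul1r -addrA [1 + _]addrC -addrA lerDl addr_ge0.
move=> /(ler_wpM2r (ltW eps0))/le_trans; apply.
by rewrite mulrC mulrAC ler_pdivrMr // ler_pM2l // lerDr addr_ge0 // ltW.
Qed.

(** AM-GM bounds each row sum to the power k by k^k times the product of its
    variables; in the product over all rows each variable occurs k times. *)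
Lemma regular_cap C e k : (0 < k)%N -> (forall i, #|[set j | e i j]| = k) ->
  (forall j, #|[set i | e i j]| = k) ->
  forall x : I -> C, (forall i, 0 < x i) ->
  k%:R ^+ #|I| * \prod_i x i <= \prod_i \sum_(j in [set j | e i j]) x j.
Proof.
move=> k0 rowk colk x x0.
have S0 i : 0 <= \sum_(j in [set j | e i j]) x j by apply: sumr_ge0 => j _; exact: ltW.
rewrite -(ler_pXn2r k0) ?nnegrE; first last.
- exact: prodr_ge0.
- by rewrite mulr_ge0 ?exprn_ge0 // prodr_ge0 // => i _; exact: ltW.
rewrite -!prodrXl.
have : \prod_i \prod_(j in [set j | e i j]) (x j *+ k) <=
       \prod_i (\sum_(j in [set j | e i j]) x j) ^+ k.
  apply: ler_prod => i _; rewrite prodr_ge0 /=; last by move=> j _; rewrite mulrn_wge0 ?ltW.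
  rewrite -[in X in X <= _](rowk i) -[X in _ ^+ X](rowk i).
  by apply: leif_AGM_scaled => j _; rewrite mulrn_wge0 ?ltW.
apply: le_trans; rewrite le_eqVlt; apply/orP; left; apply/eqP.
rewrite exprMn -prodrXl.
transitivity (\prod_j \prod_(i in [set i | e i j]) (x j *+ k)).
  under [RHS]eq_bigr => j _ do rewrite prodr_const colk -mulr_natl exprMn.
  by rewrite big_split prodr_const /= exprAC.
rewrite (exchange_big_dep xpredT) //=; apply: eq_bigr => i _.
by apply: eq_bigl => j; rewrite !inE.
Qed.

(** The positive matrix e + eps inherits the capacity bound of e, and its
    permanent is a polynomial in eps whose value at 0 counts the permutations
    compatible with e. *)
Theorem regular_permanent_ge e k : (0 < k)%N ->
  (forall i, #|[set j | e i j]| = k) -> (forall j, #|[set i | e i j]| = k) ->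
  (k ^ #|I| * (#|I|)`! <=
     #|I| ^ #|I| * #|[set s : {perm I} | [forall i, e i (s i)]]|)%N.
Proof.
move=> k0 rowk colk; set N := #|_|.
pose a : I -> I -> {poly algC} := fun i j => (e i j)%:R%:P + 'X.
pose q := mixed_coef a setT (fun=> 1).
have qE eps : q.[eps] = mixed_coef (fun i j => (e i j)%:R + eps) setT (fun=> 1).
  rewrite horner_sum; apply: eq_bigr => s _; rewrite horner_prod.
  by apply: eq_bigr => i _; rewrite inE !mulr1 /a !hornerE.
have q0 : q.[0] = N%:R.
  rewrite qE.
  transitivity (#|[set s | hits_once setT s & [forall i, e i (s i)]]|%:R : algC).
    rewrite -sum1_card natr_sum; under [RHS]eq_bigl do rewrite inE.
    rewrite [RHS]big_mkcondr /=.
    apply: eq_bigr => s _; case: ifPn => [/forallP h|].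
      by rewrite big1 // => i _; rewrite inE h addr0 mulr1.
    rewrite negb_forall => /existsP[i /negPf ei].
    by rewrite (bigD1 i) //= inE ei addr0 mulr1 mul0r.
  congr _%:R; rewrite /N -(card_imset _ (@val_inj _ _ {perm I})); apply: eq_card => s.
  rewrite inE; apply/andP/imsetP => [[/forall_inP s1 es]|[u]].
    have s_inj : injectiveb s.
      apply/injectiveP => i i' si; apply/eqP; move: (s1 (s i) (in_setT _)).
      case/cards1P => l /setP sl; move: (sl i) (sl i').
      by rewrite !inE si eqxx => /esym/eqP-> /esym/eqP->.
    exists (Sub s s_inj); last by rewrite SubK.
    by rewrite inE; apply/forallP => i; move/forallP/(_ i): es; rewrite -pvalE /=.
  rewrite inE => /forallP eu ->; split.
    apply/forall_inP => j _; apply/cards1P; exists (u^-1%g j).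
    by apply/setP => i; rewrite !inE -[RHS](inj_eq (@perm_inj _ u)) permKV -pvalE.
  by apply/forallP => i; move: (eu i); rewrite -pvalE.
have : (k%:R ^+ #|I| * (#|I|)`!%:R / #|I|%:R ^+ #|I|) <= q.[0].
  apply: nneg_poly_ge_at0.
    pose nn (p : {poly algC}) := forall i, 0 <= p`_i.
    apply: (big_ind nn) => [i|p1 p2 h1 h2 i|s _]; rewrite ?coef0 ?coefD ?addr_ge0 //.
    apply: (big_ind nn) => [i|p1 p2 h1 h2 i|l _ i]; first by rewrite coef1 ler0n.
      by rewrite coefM sumr_ge0 // => l _; rewrite mulr_ge0.
    by rewrite inE mulr1 coefD coefC coefX addr_ge0 ?ler0n //; case: ifP; rewrite ?ler0n.
  move=> eps eps0; rewrite qE; apply: mixed_coefT_ge.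
    by move=> i j; rewrite ltr_wpDl.
  move=> x x0; rewrite mixed_coef0 setC0.
  under eq_bigl do rewrite inE.
  apply: le_trans (regular_cap k0 rowk colk x0) _.
  apply: ler_prod => i _; apply/andP; split; first by apply: sumr_ge0 => j _; exact: ltW.
  rewrite big_mkcond; apply: ler_sum => j _; rewrite inE.
  case: (e i j); last by rewrite add0r mulr_ge0 ?ltW.
  by rewrite mulrDl mul1r lerDl mulr_ge0 ?ltW.
have nn : (0 < #|I| ^ #|I|)%N by rewrite expn_gt0; case: #|I|.
rewrite q0 -!natrX ler_pdivrMr ?ltr0n // -!natrM ler_nat.
by rewrite [X in (_ <= X)%N]mulnC.
Qed.

End RegularPermanent.

(** * Counting Latin squares from below *)
Section LatinCount.
Local Open Scope nat_scope.
Variable n : nat.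
Implicit Types (s u : 'S_n).

Definition discordant s u := [forall j, s j != u j].

(** Latin rectangles with r rows, a row being the permutation that sends a
    column to its symbol. *)
Definition rectangles r := [set t : r.-tuple 'S_n | pairwise discordant t].

Definition free_symbol (t : seq 'S_n) : rel 'I_n :=
  fun j k => all (fun s => s j != k) t.

Lemma card_free_symbols r (t : r.-tuple 'S_n) j :
  t \in rectangles r -> #|[set k | free_symbol t j k]| = n - r.
Proof.
rewrite inE => tP.
have ut : uniq [seq s j | s : 'S_n <- t].
  rewrite uniq_pairwise pairwise_map; apply: sub_pairwise tP => s u /forallP; exact.
have -> : [set k | free_symbol t j k] = ~: [set k in [seq s j | s : 'S_n <- t]].
  apply/setP => k; rewrite !inE; apply/allP/negP => [h /mapP[s st ks]|h s st].
    by have := h s st; rewrite ks eqxx.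
  by apply: contra_notN h => /eqP <-; apply: map_f.
rewrite cardsCs setCK card_ord cardsE (card_uniqP ut) size_map size_tuple //.
Qed.

Lemma card_free_columns r (t : r.-tuple 'S_n) k :
  t \in rectangles r -> #|[set j | free_symbol t j k]| = n - r.
Proof.
rewrite inE => tP.
have ut : uniq [seq (s^-1)%g k | s : 'S_n <- t].
  rewrite uniq_pairwise pairwise_map; apply: sub_pairwise tP => s u /forallP su.
  by apply: contraTneq (su (u^-1%g k)) => /= e; rewrite -{1}e !permKV negbK.
have -> : [set j | free_symbol t j k] = ~: [set j in [seq (s^-1)%g k | s : 'S_n <- t]].
  apply/setP => j; rewrite !inE; apply/allP/negP => [h /mapP[s st ks]|h s st].
    by have := h s st; rewrite ks permKV eqxx.
  by apply: contra_notN h => /eqP <-; apply/mapP; exists s; rewrite ?permK.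
rewrite cardsCs setCK card_ord cardsE (card_uniqP ut) size_map size_tuple //.
Qed.

(** The rows that extend a Latin rectangle are the permutations compatible with
    an (n-r)-regular relation. *)
Lemma card_extensions r (t : r.-tuple 'S_n) : r < n -> t \in rectangles r ->
  (n - r) ^ n * n`! <= n ^ n * #|[set s | all (discordant s) t]|.
Proof.
move=> rn tP.
have := @regular_permanent_ge _ (free_symbol t) (n - r).
rewrite card_ord subn_gt0 => /(_ rn).
move=> /(_ (fun j => card_free_symbols j tP) (fun k => card_free_columns k tP)).
congr (_ <= _ * _); apply: eq_card => s; rewrite !inE.
apply/forallP/allP => [h u ut|h j].
  by apply/forallP => j; rewrite eq_sym; exact: (allP (h j)).
by apply/allP => u /h/forallP/(_ j); rewrite eq_sym.
Qed.

Lemma card_rectanglesS r : r < n ->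
  #|rectangles r| * ((n - r) ^ n * n`!) <= n ^ n * #|rectangles r.+1|.
Proof.
move=> rn; rewrite -[#|rectangles r.+1|]sum1_card.
rewrite (partition_big (fun t : r.+1.-tuple 'S_n => behead_tuple t : r.-tuple 'S_n)
           (fun t => t \in rectangles r)) /=; last first.
  move=> t; rewrite !inE; by case/tupleP: t => s t /= /andP[_].
rewrite -sum_nat_const big_distrr; apply: leq_sum => t tP.
apply: leq_trans (card_extensions rn tP) _; rewrite leq_mul2l; apply/orP; right.
rewrite sum1_card -(@card_imset _ _ (fun s => cons_tuple s t)); last first.
  by move=> s u [].
apply/subset_leq_card/subsetP => _ /imsetP[s + ->].
rewrite inE => st; apply/andP; split; last exact/eqP/val_inj.
by move: tP; rewrite !inE /= st.
Qed.

Lemma card_rectangles_ge r : r <= n ->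
  (n ^_ r) ^ n * n`! ^ r <= (n ^ n) ^ r * #|rectangles r|.
Proof.
elim: r => [_|r IH rn].
  rewrite ffactn0 exp1n !mul1n; apply/card_gt0P; exists [tuple]; by rewrite inE.
rewrite ffactnSr expnMn !expnSr mulnACA.
apply: leq_trans (leq_mul (IH (ltnW rn)) (leqnn _)) _.
by rewrite -!mulnA leq_mul2l card_rectanglesS ?orbT.
Qed.

Definition latin_of (t : n.-tuple 'S_n) : {set triples n} :=
  [set c | tnth t c.1.1 c.1.2 == c.2].

Lemma latin_of_inj : injective latin_of.
Proof.
move=> t u tu; apply: eq_from_tnth => i; apply/permP => j.
by have /setP/(_ (i, j, tnth u i j)) := tu; rewrite !inE /= eqxx => /eqP.
Qed.

Lemma latin_ofP t : t \in rectangles n -> latin (latin_of t).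
Proof.
rewrite inE => /(pairwiseP 1%g) tP.
have lt_neq (i i' : 'I_n) j : i < i' -> tnth t i j != tnth t i' j.
  move=> lt; rewrite !(tnth_nth 1%g); apply/forallP: j.
  by apply: tP; rewrite // inE size_tuple.
have inj j : injective (fun i => tnth t i j).
  move=> i i' /eqP; case: (ltngtP i i') => [/lt_neq/negPf->|/lt_neq/negPf h|/val_inj] //.
  by rewrite eq_sym h.
apply/and3P; split; apply/forallP => x; apply/forallP => y; apply/cards1P.
- by exists (tnth t x y); apply/setP => z; rewrite !inE eq_sym.
- exists ((tnth t x)^-1%g y); apply/setP => z; rewrite !inE /=.
  by rewrite -[RHS](inj_eq (@perm_inj _ (tnth t x))) permKV.
exists (invF (inj x) y); apply/setP => z; rewrite !inE /=.
by rewrite -[in RHS](inj_eq (@inj x)) (f_invF (@inj x)).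
Qed.

Theorem card_latin_ge :
  n`! ^ (2 * n) <= n ^ (n ^ 2) * #|[set L : {set triples n} | latin L]|.
Proof.
apply: leq_trans (_ : _ <= (n ^ n) ^ n * #|rectangles n|) _.
  by have := card_rectangles_ge (leqnn n); rewrite ffactnn -expnD addnn mul2n.
rewrite -expnM leq_mul2l; apply/orP; right; rewrite -(card_imset _ latin_of_inj).
apply/subset_leq_card/subsetP => _ /imsetP[t tP ->].
by rewrite inE latin_ofP.
Qed.

End LatinCount.

(** * Counting Latin squares from above *)
Section CriticalSets.
Local Open Scope nat_scope.
Variables (n : nat) (l : 'I_n).
Implicit Types (L C : {set triples n}) (i j k : 'I_n).

Lemma latin_symbol L i j : latin L -> exists k, (i, j, k) \in L.
Proof.
by case/and3P => /forallP/(_ i)/forallP/(_ j)/cards1P[k e] _ _;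
  exists k; move/setP/(_ k): e; rewrite !inE eqxx.
Qed.

Lemma latin_column L i k : latin L -> exists j, (i, j, k) \in L.
Proof.
by case/and3P => _ /forallP/(_ i)/forallP/(_ k)/cards1P[j e] _;
  exists j; move/setP/(_ j): e; rewrite !inE eqxx.
Qed.

Lemma latin_row L j k : latin L -> exists i, (i, j, k) \in L.
Proof.
by case/and3P => _ _ /forallP/(_ j)/forallP/(_ k)/cards1P[i e];
  exists i; move/setP/(_ i): e; rewrite !inE eqxx.
Qed.

Lemma latin_partial L : latin L -> partial_latin L.
Proof.
case/and3P => h1 h2 h3.
apply/and3P; split; apply/forallP => x; apply/forallP => y.
- by rewrite (eqP (forallP (forallP h1 x) y)).
- by rewrite (eqP (forallP (forallP h2 x) y)).
- by rewrite (eqP (forallP (forallP h3 x) y)).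
Qed.

Lemma partial_latinS C L : C \subset L -> partial_latin L -> partial_latin C.
Proof.
move=> /subsetP CL /and3P[h1 h2 h3].
apply/and3P; split; apply/forallP => x; apply/forallP => y.
- apply: leq_trans (forallP (forallP h1 x) y); apply/subset_leq_card/subsetP => z.
  by rewrite !inE; exact: CL.
- apply: leq_trans (forallP (forallP h2 x) y); apply/subset_leq_card/subsetP => z.
  by rewrite !inE; exact: CL.
- apply: leq_trans (forallP (forallP h3 x) y); apply/subset_leq_card/subsetP => z.
  by rewrite !inE; exact: CL.
Qed.

Lemma partial_symbol_inj C i j k k' : partial_latin C ->
  (i, j, k) \in C -> (i, j, k') \in C -> k = k'.
Proof.
by case/and3P => /forallP/(_ i)/forallP/(_ j)/card_le1_eqP h _ _ ck ck'; apply: h; rewrite inE.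
Qed.

Lemma partial_column_inj C i j j' k : partial_latin C ->
  (i, j, k) \in C -> (i, j', k) \in C -> j = j'.
Proof.
by case/and3P => _ /forallP/(_ i)/forallP/(_ k)/card_le1_eqP h _ ck ck'; apply: h; rewrite inE.
Qed.

Lemma partial_row_inj C i i' j k : partial_latin C ->
  (i, j, k) \in C -> (i', j, k) \in C -> i = i'.
Proof.
by case/and3P => _ _ /forallP/(_ j)/forallP/(_ k)/card_le1_eqP h ck ck'; apply: h; rewrite inE.
Qed.

Lemma latin_subset_eq L L' : latin L -> latin L' -> L \subset L' -> L' = L.
Proof.
move=> lL lL' /subsetP LL'; apply/eqP; rewrite eqEsubset andbC; apply/andP; split.
  exact/subsetP.
apply/subsetP => -[[i j] k] kL'; have [k' k'L] := latin_symbol i j lL.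
by rewrite (partial_symbol_inj (latin_partial lL') kL' (LL' _ k'L)).
Qed.

Definition off_cross : {set 'I_n * 'I_n} := setX [set~ l] [set~ l].

(** If [L] and [L'] differ in a cell of row i and column l, then the symbol
    of [L'] there occurs in [L] elsewhere in row i, at a cell where [L'] agrees
    with [L]; so [L'] has it twice in row i. This settles the column l outside
    the corner; the row l is symmetric, and then the corner is a cell of a row
    known elsewhere. *)
Lemma off_cross_determines L L' : latin L -> latin L' ->
  [set c in L | c.1 \in off_cross] \subset L' -> L' = L.
Proof.
move=> lL lL' /subsetP sub; apply: latin_subset_eq => //.
have [pL pL'] := (latin_partial lL, latin_partial lL').
have in_block i j k : i != l -> j != l -> (i, j, k) \in L -> (i, j, k) \in L'.
  by move=> il jl kL; apply: sub; rewrite !inE kL /= il jl.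
have row i k : (forall j k', j != l -> (i, j, k') \in L -> (i, j, k') \in L') ->
    (i, l, k) \in L -> (i, l, k) \in L'.
  move=> h kL; have [k' k'L'] := latin_symbol i l lL'.
  have [j jL] := latin_column i k' lL.
  have [jl|jl] := eqVneq j l.
    by move: jL; rewrite jl => /(partial_symbol_inj pL kL)->.
  by move: (jl); rewrite (partial_column_inj pL' (h _ _ jl jL) k'L') eqxx.
have col j k : j != l -> (l, j, k) \in L -> (l, j, k) \in L'.
  move=> jl kL; have [k' k'L'] := latin_symbol l j lL'.
  have [i iL] := latin_row j k' lL.
  have [il|il] := eqVneq i l.
    by move: iL; rewrite il => /(partial_symbol_inj pL kL)->.
  by move: (il); rewrite (partial_row_inj pL' (in_block _ _ _ il jl iL) k'L') eqxx.
apply/subsetP => -[[i j] k].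
have [->|jl] := eqVneq j l; have [->|il] := eqVneq i l.
- by apply: row => j' k' j'l; exact: col.
- by apply: row => j' k' j'l; exact: in_block.
- exact: col.
- exact: in_block.
Qed.

Lemma critical_off_cross L : latin L ->
  exists2 C : {set triples n}, critical_set L C & [set c.1 | c in C] \subset off_cross.
Proof.
move=> lL; pose B := [set c in L | c.1 \in off_cross].
have BL : B \subset L by apply/subsetP => c; rewrite inE => /andP[].
have uB : uniquely_completable L B.
  apply/and4P; split=> //; first exact: partial_latinS BL (latin_partial lL).
  apply/forallP => L'; apply/implyP => /andP[lL' BL'].
  by apply/eqP; exact: off_cross_determines.
have [C /minsetP[uC minC] CB] := minset_exists uB.
exists C.
  rewrite /critical_set uC; apply/forallP => D; apply/implyP => DC.
  apply/negP => /minC/(_ (proper_sub DC)) e; by rewrite e properxx in DC.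
by apply/subsetP => _ /imsetP[c /(subsetP CB) + ->]; rewrite inE => /andP[].
Qed.

Lemma uniquely_completable_inj L L' C :
  uniquely_completable L C -> uniquely_completable L' C -> L = L'.
Proof.
case/and4P => _ _ _ /forallP/(_ L')/implyP h /and4P[lL' _ CL' _].
by apply/esym/eqP/h; rewrite lL'.
Qed.

(** The content of the cells, with the dummy symbol [l] in the empty ones; a
    partial Latin square is recovered from it and the set of filled cells. *)
Definition entries C : {ffun 'I_n * 'I_n -> 'I_n} :=
  [ffun d => odflt l [pick k | (d, k) \in C]].

Lemma entriesE C c : partial_latin C ->
  (c \in C) = (c.1 \in [set c.1 | c in C]) && (c.2 == entries C c.1).
Proof.
move=> pC; apply/idP/andP => [cC|[/imsetP[[d k'] dC /= e] /eqP]].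
  split; first exact: imset_f.
  case: c cC => [[i j] k] cC; rewrite ffunE; case: pickP => [k' k'C|/(_ k)] /=.
    by apply/eqP; exact: partial_symbol_inj pC cC k'C.
  by rewrite cC.
case: c e => d' k /= ->; rewrite ffunE; case: pickP => [k'' ? -> //|/(_ k')].
by rewrite dC.
Qed.

Lemma card_partial_latin_shape (D : {set 'I_n * 'I_n}) :
  #|[set C : {set triples n} | partial_latin C & [set c.1 | c in C] == D]| <= n ^ #|D|.
Proof.
rewrite -[X in X ^ _]card_ord -(card_pffun_on l D predT).
rewrite -(@card_in_imset _ _ entries) => [|C C'].
  apply/subset_leq_card/subsetP => _ /imsetP[C + ->].
  rewrite inE => /andP[pC /eqP sC]; apply/pffun_onP; split => //.
  apply/subsetP => d; rewrite inE /= ffunE; case: pickP => [k dk _|]; last by rewrite eqxx.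
  by rewrite -sC; apply/imsetP; exists (d, k).
rewrite !inE => /andP[pC /eqP sC] /andP[pC' /eqP sC'] e.
by apply/setP => c; rewrite !entriesE // sC sC' e.
Qed.

Lemma card_off_cross : #|off_cross| = n.-1 ^ 2.
Proof. by rewrite cardsX cardsC1 card_ord mulnn. Qed.

(** A choice of critical sets off the cross is injective on Latin squares. The
    sets with a given shape D are counted by [card_partial_latin_shape]; if
    there is one, it witnesses that D has at most [lcs n] cells. *)
Theorem card_latin_le :
  #|[set L : {set triples n} | latin L]| <= 2 ^ (n.-1 ^ 2) * n ^ lcs n.
Proof.
pose good L C := critical_set L C && ([set c.1 | c in C] \subset off_cross).
pose crit L := odflt set0 [pick C | good L C].
have critP L : latin L -> good L (crit L).
  move=> lL; rewrite /crit; case: pickP => //= h.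
  by have [C cC sC] := critical_off_cross lL; have := h C; rewrite /good cC sC.
have crit_inj : {in [set L : {set triples n} | latin L] &, injective crit}.
  move=> L L'; rewrite !inE => /critP/andP[/andP[uL _] _] /critP/andP[/andP[uL' _] _] e.
  by apply: uniquely_completable_inj uL _; rewrite e.
rewrite -(card_in_imset crit_inj); set A := crit @: _.
have goodA C : C \in A -> exists2 L, critical_set L C & [set c.1 | c in C] \subset off_cross.
  by case/imsetP => L; rewrite inE => /critP/andP[cC sC] ->; exists L.
rewrite -sum1_card (partition_big (fun C : {set triples n} => [set c.1 | c in C])
  (fun D => D \in powerset off_cross)) /=; last first.
  by move=> C /goodA[L _ sC]; rewrite inE.
rewrite -card_off_cross -card_powerset -sum_nat_const; apply: leq_sum => D _.
have n0 : 0 < n by apply: leq_ltn_trans (ltn_ord l).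
rewrite sum1_card -cardsE; set S := finset _.
have [->|[C0]] := set_0Vmem S; first by rewrite cards0.
rewrite inE => /andP[/goodA[L cC0 _] /eqP sC0].
have D_le : #|D| <= lcs n.
  rewrite -sC0; apply: leq_trans (leq_imset_card _ _) _.
  rewrite /lcs (bigop.bigmax_sup C0) //; apply/existsP; by exists L.
apply: leq_trans (leq_trans (card_partial_latin_shape D) (leq_pexp2l n0 D_le)).
apply/subset_leq_card/subsetP => C; rewrite !inE => /andP[/goodA[L' cC _] ->].
by case/andP: cC => /and4P[_ -> _ _] _.
Qed.

End CriticalSets.

(** * Stirling's lower bound *)
Section Stirling.
Local Open Scope classical_set_scope.
Local Open Scope ring_scope.
Variable R : realType.

Lemma is_derive_ge0_le (f df : R -> R) (a b : R) : a <= b ->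
  (forall x, a <= x <= b -> is_derive x 1 f (df x)) ->
  (forall x, a <= x <= b -> 0 <= df x) -> f a <= f b.
Proof.
move=> ab fdf df0.
have fdf' x : x \in `]a, b[ -> is_derive x 1 f (df x).
  by rewrite in_itv /= => /andP[/ltW ax /ltW xb]; apply: fdf; rewrite ax.
have cf : {within `[a, b], continuous f}.
  by apply: derivable_within_continuous => x; rewrite in_itv /= => /fdf [].
have [c cab] := MVT_segment ab fdf' cf.
move=> fE; rewrite -subr_ge0 fE mulr_ge0 ?subr_ge0 // df0 //.
Qed.

(** Antiderivatives of the powers of the sine, by the usual reduction formula:
    with them Wallis' argument needs only monotonicity, and no integral. *)
Fixpoint sin_prim (m : nat) (x : R) : R :=
  match m with
  | 0 => x
  | 1 => - cos x
  | m'.+2 => (m'.+1%:R * sin_prim m' x - cos x * sin x ^+ m'.+1) / m'.+2%:R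
  end.

Lemma is_derive_sin_prim m (x : R) : is_derive x 1 (sin_prim m) (sin x ^+ m).
Proof.
have [k] := ubnP m; elim: k m => // k IH [|[|m]] hm.
- by rewrite expr0; exact: is_derive_id.
- by rewrite expr1; apply: is_derive_eq; rewrite opprK.
- have := IH m (ltnW (hm : (m.+1 < k)%N)) => h.
  have -> : sin_prim m.+2 =
      m.+2%:R^-1 \*: (m.+1%:R \*: sin_prim m - cos * sin ^+ m.+1).
    apply/funext => y; transitivity
      (m.+2%:R^-1 * (m.+1%:R * sin_prim m y - cos y * (sin ^+ m.+1) y)) => //.
    by rewrite exprfctE /= mulrC.
  apply: is_derive_eq; rewrite /GRing.scale /= exprfctE /=.
  rewrite !exprS; have : cos x ^+ 2 = 1 - sin x ^+ 2.
    by rewrite -(cos2Dsin2 x) addrK.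
  set c := cos x; set s := sin x; move=> cc.
  have -> : c * (m.+1%:R * s ^+ m * c) + s * s ^+ m * - s =
      m.+1%:R * s ^+ m * c ^+ 2 - s ^+ 2 * s ^+ m by ring.
  by rewrite cc -!natr1; field; rewrite !natr1 pnatr_eq0.
Qed.

(** The integral of sin^m over [0, pi/2]. *)
Definition wallis m : R := sin_prim m (pi / 2) - sin_prim m 0.

Lemma wallisSS m : wallis m.+2 = m.+1%:R / m.+2%:R * wallis m.
Proof. by rewrite /wallis /= cos_pihalf sin0 expr0n /=; ring. Qed.

Lemma wallis0 : wallis 0 = pi / 2.
Proof. by rewrite /wallis /= subr0. Qed.

Lemma wallis1 : wallis 1 = 1.
Proof. by rewrite /wallis /= cos_pihalf cos0; ring. Qed.

Lemma wallisS_le m : wallis m.+1 <= wallis m.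
Proof.
rewrite -subr_ge0.
have -> : wallis m - wallis m.+1 =
    (sin_prim m (pi / 2) - sin_prim m.+1 (pi / 2)) -
    (sin_prim m 0 - sin_prim m.+1 0).
  by rewrite /wallis; ring.
rewrite subr_ge0.
have pi0 := pi_gt0 R.
apply: (@is_derive_ge0_le (sin_prim m \- sin_prim m.+1)
          (fun x => sin x ^+ m - sin x ^+ m.+1)).
- lra.
- move=> x _; have h1 := is_derive_sin_prim m x.
  by have h2 := is_derive_sin_prim m.+1 x; exact: is_deriveB.
move=> x /andP[x0 x1].
have s0 : 0 <= sin x by apply: sin_ge0_pi; apply/andP; split => //; lra.
by rewrite exprS -{1}[sin x ^+ m]mul1r -mulrBl mulr_ge0 ?exprn_ge0 // subr_ge0 sin_le1.
Qed.

(** The reduction formula makes this product independent of m. *)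
Lemma wallis_mul m : m.+1%:R * (wallis m.+1 * wallis m) = pi / 2.
Proof.
elim: m => [|m IH]; first by rewrite wallis0 wallis1; ring.
rewrite wallisSS -IH; by field; rewrite gt_eqF // ltr_wpDr.
Qed.

Lemma wallis_even m : wallis m.*2 = pi / 2 * (m.*2`!%:R / (m`!%:R ^+ 2 * 4 ^+ m)).
Proof.
elim: m => [|m IH]; first by rewrite wallis0 double0 fact0; field.
rewrite doubleS wallisSS IH !factS !natrM.
have f0 : m`!%:R != 0 :> R by rewrite pnatr_eq0 -lt0n fact_gt0.
have p0 : (4 : R) ^+ m != 0 by rewrite expf_neq0 ?pnatr_eq0.
have -> : (4 : R) ^+ m.+1 = 4 * 4 ^+ m by rewrite exprS.
have m0 : 0 <= m%:R :> R by [].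
rewrite -[m.*2.+2%:R]natr1 -[m.*2.+1%:R]natr1 -[m.+1%:R]natr1 -muln2 natrM; field.
by rewrite p0 f0 !gt_eqF // ?ltr_wpDl // ?mulr_ge0 // addr_ge0 ?mulr_ge0.
Qed.

(** (2m choose m) <= 4^m / sqrt(pi m), squared and without denominators: with
    W = [wallis], this is W(2m)^2 <= W(2m) W(2m-1) = pi / (4m). *)
Lemma central_binomial_le m : (0 < m)%N ->
  pi * m%:R * (m.*2`!%:R) ^+ 2 <= (m`!%:R) ^+ 4 * 16 ^+ m :> R.
Proof.
case: m => // m _.
have pi0 := pi_gt0 R.
have w0 : 0 <= wallis m.+1.*2.
  rewrite wallis_even mulr_ge0 ?divr_ge0 ?mulr_ge0 ?exprn_ge0 //; exact: ltW.
have := wallisS_le m.*2.+1; rewrite -doubleS => /(ler_wpM2l w0) h.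
have := wallis_mul m.*2.+1; rewrite -doubleS => wm.
have m0 : 0 < (m.+1.*2)%:R :> R by rewrite ltr0n.
have {h} := ler_wpM2l (ltW m0) h; rewrite wm wallis_even.
have f0 : 0 < m.+1`!%:R :> R by rewrite ltr0n fact_gt0.
have -> : (16 : R) ^+ m.+1 = (4 ^+ m.+1) ^+ 2.
  by rewrite -exprM mulnC exprM; congr (_ ^+ _); ring.
have p0 : 0 < (4 : R) ^+ m.+1 by rewrite exprn_gt0.
set F := m.+1`!%:R in f0 *; set P := 4 ^+ _ in p0 *; set G := _`!%:R; rewrite -muln2 natrM.
set M := m.+1%:R.
have -> : M * 2 * (pi / 2 * (G / (F ^+ 2 * P)) * (pi / 2 * (G / (F ^+ 2 * P)))) =
  pi / 2 * ((pi * M * G ^+ 2) / (F ^+ 4 * P ^+ 2)).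
  by field; rewrite !gt_eqF.
rewrite -{2}[pi / 2]mulr1 ler_pM2l; last by lra.
by rewrite ler_pdivrMr ?mul1r // mulr_gt0 ?exprn_gt0.
Qed.

(** The logarithm of m! / (sqrt(2 pi m) (m/e)^m). *)
Definition stirling_gap (m : nat) : R :=
  ln m`!%:R - ((ln (2 * pi) + ln m%:R) / 2 + m%:R * ln m%:R - m%:R).

(** The difference of the two sides is
    ln (4^m / (sqrt(pi m) (2m choose m))). *)
Lemma stirling_gap_double m : (0 < m)%N -> stirling_gap m.*2 <= 2 * stirling_gap m.
Proof.
move=> m0; have mr : 0 < m%:R :> R by rewrite ltr0n.
have pi0 := pi_gt0 R.
have f0 k : 0 < k`!%:R :> R by rewrite ltr0n fact_gt0.
have p16 : 0 < (16 : R) ^+ m by rewrite exprn_gt0.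
have := central_binomial_le m0.
rewrite -ler_ln ?posrE ?mulr_gt0 ?exprn_gt0 // !lnM ?posrE ?mulr_gt0 ?exprn_gt0 // !lnXn //.
have -> : (16 : R) = 2 ^+ 4 by rewrite -natrX.
rewrite lnXn // /stirling_gap -[in m.*2%:R]muln2 natrM !lnM ?posrE //.
set p := ln pi; set x := ln m%:R; set t := ln 2; set F := ln m`!%:R; set G := ln _.
rewrite -subr_ge0 => h; rewrite -subr_ge0.
set L := (X in 0 <= X); set H := (X in 0 <= X) in h.
have -> : L = H / 2 by rewrite /L /H; field.
by rewrite divr_ge0.
Qed.

(** This is m! >= (m/e)^m, read off one term of the series of exp m. *)
Lemma stirling_gap_crude m : (0 < m)%N ->
  - (ln (2 * pi) + ln m%:R) / 2 <= stirling_gap m.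
Proof.
case: m => // m _; set N := m.+1.
have N0 : 0 < N%:R :> R by rewrite ltr0n.
have f0 : 0 < N`!%:R :> R by rewrite ltr0n fact_gt0.
have : N%:R ^+ N <= expR N%:R * N`!%:R :> R.
  rewrite -ler_pdivrMr //; apply: le_trans (expR_ge1Dxn m (ltW N0)).
  by rewrite lerDr.
rewrite -ler_ln ?posrE ?mulr_gt0 ?exprn_gt0 ?expR_gt0 // lnM ?posrE ?expR_gt0 // expRK lnXn //.
rewrite /stirling_gap.
set c := ln (2 * pi); set x := ln N%:R; set F := ln N`!%:R.
rewrite -subr_ge0 => h; rewrite -subr_ge0.
by apply: le_trans h _; rewrite le_eqVlt; apply/orP; left; apply/eqP; field.
Qed.

(** A negative [e] would make e 2^k decrease exponentially. At the even
    exponent 2k it is enough to compare with k^2 <= 4^k. *)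
Lemma ge0_of_exp_ge (e a b : R) : 0 <= a -> 0 <= b ->
  (forall k, - (a * k%:R + b) <= e * 2 ^+ k) -> 0 <= e.
Proof.
move=> a0 b0 h; rewrite leNgt; apply/negP => e0.
have e0' : 0 < - e by rewrite oppr_gt0.
have q0 : 0 <= (a * 2 + b) / - e by rewrite divr_ge0 ?addr_ge0 ?mulr_ge0 // ltW.
have := archi_boundP q0; set k := Num.bound _ => hk.
have k1 : 1 <= k%:R :> R by rewrite ler1n -(ltr0n R); exact: le_lt_trans hk.
rewrite ltr_pdivrMr // in hk.
have k0 : 0 < k%:R :> R := lt_le_trans ltr01 k1.
have k2 : k%:R ^+ 2 <= (2 : R) ^+ (2 * k).
  by rewrite mulnC exprM -!natrX ler_nat leq_exp2r // ltnW // ltn_expl.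
have := h (2 * k)%N; rewrite natrM lerNl -mulNr => h'.
have : - e * k%:R ^+ 2 <= (a * 2 + b) * k%:R.
  apply: le_trans (ler_wpM2l (ltW e0') k2) _.
  have -> : (a * 2 + b) * k%:R = a * (2 * k%:R) + b * k%:R by ring.
  by apply: le_trans h' _; rewrite lerD2l ler_peMr.
by rewrite expr2 mulrA ler_pM2r // leNgt [- e * _]mulrC hk.
Qed.

(** Stirling's lower bound: apply [ge0_of_exp_ge] to the values of
    [stirling_gap] at the m 2^k. *)
Lemma ln_fact_ge m : (0 < m)%N ->
  (ln (2 * pi) + ln m%:R) / 2 + m%:R * ln m%:R - m%:R <= ln m`!%:R :> R.
Proof.
move=> m0; rewrite -subr_ge0 -/(stirling_gap m).
have ln2 : 0 <= ln (2 : R) by rewrite ln_ge0 // ler1n.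
have m1 : 0 <= ln (m%:R : R) by rewrite ln_ge0 // ler1n.
have pi2 : 0 <= ln (2 * pi : R).
  by rewrite ln_ge0 // (le_trans _ (ler_wpM2l _ (pi_ge2 R))) // -natrM ler1n.
apply: (@ge0_of_exp_ge _ (ln 2 / 2) ((ln (2 * pi) + ln m%:R) / 2)).
- by rewrite divr_ge0.
- by rewrite divr_ge0 ?addr_ge0.
move=> k.
have pk : (0 < 2 ^ k * m)%N by rewrite muln_gt0 expn_gt0.
have : stirling_gap (2 ^ k * m) <= stirling_gap m * 2 ^+ k.
  elim: k pk => [|k IH] pk; first by rewrite mul1n expr0 mulr1.
  have pk' : (0 < 2 ^ k * m)%N by rewrite muln_gt0 expn_gt0.
  rewrite expnS -mulnA mul2n (le_trans (stirling_gap_double pk')) //.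
  by rewrite exprS mulrCA ler_pM2l // IH.
apply: le_trans; apply: le_trans (stirling_gap_crude pk).
have mr : 0 < m%:R :> R by rewrite ltr0n.
have -> : ln (2 ^ k * m)%:R = ln 2 * k%:R + ln m%:R :> R.
  by rewrite natrM natrX lnM ?posrE ?exprn_gt0 // lnXn // mulr_natr.
by rewrite le_eqVlt; apply/orP; left; apply/eqP; field.
Qed.

End Stirling.

(** * The lower bound for lcs *)
Lemma fact_lcs_bound n : (0 < n)%N ->
  (n`! ^ (2 * n) <= n ^ (n ^ 2) * (2 ^ (n.-1 ^ 2) * n ^ lcs n))%N.
Proof.
case: n => // m _; apply: leq_trans (card_latin_ge m.+1) _.
by rewrite leq_mul2l (card_latin_le ord0) orbT.
Qed.

Theorem theorem1 (R : realType) (n : nat) (hn : (2 <= n)%N) :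
  n%:R ^+ 2 * (1 - (2 + ln 2) / ln n%:R)
  + n%:R * (1 + ln (8 * pi) / ln n%:R)
  - ln 2 / ln n%:R <= (lcs n)%:R :> R.
Proof.
have n0 : (0 < n)%N := ltnW hn.
have nr : 0 < n%:R :> R by rewrite ltr0n.
have pi0 := pi_gt0 R.
have f0 : 0 < n`!%:R :> R by rewrite ltr0n fact_gt0.
have l0 : 0 < ln (n%:R : R) by rewrite ln_gt0 // ltr1n.
have h2 : 2 * n%:R * ln n`!%:R <= n%:R ^+ 2 * ln n%:R +
    ((n%:R - 1) ^+ 2 * ln 2 + (lcs n)%:R * ln n%:R) :> R.
  have -> : n%:R - 1 = n.-1%:R :> R by rewrite -subn1 natrB.
  rewrite -[2 * n%:R]natrM -!natrX !mulr_natl -!lnXn //.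
  rewrite -!lnM ?posrE ?mulr_gt0 ?exprn_gt0 //.
  rewrite ler_ln ?posrE ?mulr_gt0 ?exprn_gt0 //.
  by rewrite -!natrX -!natrM ler_nat; exact: fact_lcs_bound.
have h1 := ler_wpM2l (ltW nr) (ln_fact_ge R n0).
(* 8 pi collects the 2 n ln 2 that come from expanding (n-1)^2 ln 2. *)
have -> : ln (8 * pi) = ln (2 * pi) + 2 * ln 2 :> R.
  have -> : 8 * pi = 2 * pi * 2 ^+ 2 :> R by ring.
  by rewrite lnM ?posrE ?mulr_gt0 ?exprn_gt0 // lnXn // [2 * ln 2]mulr_natl.
move: h1 h2 l0; set c := ln (2 * pi); set x := ln n%:R; set F := ln n`!%:R.
set t := ln 2; set s := (lcs n)%:R; set N := n%:R => h1 h2 l0.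
rewrite -(ler_pM2r l0) -subr_ge0.
have : 0 <= 2 * (N * F - N * ((c + x) / 2 + N * x - N)) +
   (N ^+ 2 * x + ((N - 1) ^+ 2 * t + s * x) - 2 * N * F).
  by rewrite addr_ge0 ?mulr_ge0 ?subr_ge0.
congr (_ <= _); field; exact: lt0r_neq0.
Qed.
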